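(* Let $K$ be a field of characteristic $0$, $m\ge2$, and let $\widehat{F_m}$ be the completion, with respect to the formal power series topology, of the free metabelian Lie algebra $F_m$ over $K$ with free generators $y_1,\dots,y_m$. Let $u=\overline{u}+u_0\in\widehat{F_m}$, where \[ \overline{u}=\sum_{r=1}^m c_ry_r,\quad c_r\in K, \] is the linear component of $u$ and \[ u_0=\sum_{p>q}[y_p,y_q]\,h_{pq}(\mathrm{ad}\,y_q,\dots,\mathrm{ad}\,y_m),\qquad h_{pq}\in K[[t_q,\dots,t_m]]. \] Then the Jacobian matrix of the inner automorphism $\exp(\mathrm{ad}\,u)$ is \[ J(\exp(\mathrm{ad}\,u))=J(\exp(\mathrm{ad}\,\overline{u}))+D_0T=I_m+(\overline{D}+D_0)T, \] where \[ \overline{D}=\left(\frac{\partial[y_j,\overline{u}]}{\partial y_i}\right)_{i,j},\quad D_0=\left(\frac{\partial[y_j,u_0]}{\partial y_i}\right)_{i,j},\quad T=\sum_{k\ge0}\frac{t^k}{(k+1)!},\quad t=\sum_{r=1}^mc_rt_r . \] More precisely, the $(i,j)$ entry of $\overline{D}$ is $\sum_{r\ne j}c_rt_r$ if $i=j$ and $-c_it_j$ if $i\ne j$; and the $(i,j)$ entry of $D_0$ is $-t_jf_i$, where \[ f_i=\sum_{p>q}\frac{\partial\bigl([y_p,y_q]h_{pq}(\mathrm{ad}\,y_q,\dots,\mathrm{ad}\,y_m)\bigr)}{\partial y_i}=\sum_{q=1}^{i-1}t_q\,h_{iq}(t_q,\dots,t_m)-\sum_{p=i+1}^{m}t_p\,h_{pi}(t_i,\dots,t_m).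 \]
   Context: $L_m$ is the free Lie algebra over $K$ on $x_1,\dots,x_m$, and $F_m=L_m/L_m''$ has free generators $y_i=x_i+L_m''$. $F_m$ is graded by total degree in the $y_i$, and $\widehat{F_m}$ (the completion for the topology with basis of open sets $r+F_m^k$, where $F_m^k$ is the $k$-th lower central term) consists of formal infinite sums $f_1+f_2+\cdots$ with $f_k$ homogeneous of degree $k$. Operators are written on the right: $u(\mathrm{ad}\,v)=[u,v]$. On the commutator ideal $\widehat{F_m'}$ the operators $\mathrm{ad}\,y_1,\dots,\mathrm{ad}\,y_m$ commute, so power series in them act there; every element of $\widehat{F_m'}$ has the form displayed for $u_0$. $\exp(\mathrm{ad}\,u)=\sum_{k\ge0}(\mathrm{ad}\,u)^k/k!$ is an automorphism of $\widehat{F_m}$, called inner. Partial derivatives. Let $A_m,B_m$ be abelian Lie algebras with bases $a_1,\dots,a_m$ and $b_1,\dots,b_m$. Let $C_m=\bigoplus_{i=1}^m a_iK[t_1,\dots,t_m]$ be the free right $K[t_1,\dots,t_m]$-module on $a_1,\dots,a_m$ with trivial Lie bracket. The abelian wreath product is the semidirect sum of $C_m$ and $B_m$ with $[C_m,C_m]=[B_m,B_m]=0$ and $[a_if,b_j]=a_i f t_j$. The homomorphism $\varepsilon$ of $F_m$ into it given by $\varepsilon(y_i)=a_i+b_i$ is injective, and it extends to the completions, with $\widehat{C_m}=\bigoplus_i a_iK[[t_1,\dots,t_m]]$ in place of $C_m$. If $\varepsilon(f)=\sum_i\beta_ib_i+\sum_ia_if_i(t_1,\dots,t_m)$ with $\beta_i\in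 K$, then $\partial f/\partial y_i:=f_i$. For an endomorphism $\phi$, its Jacobian matrix is $J(\phi)=\left(\partial\phi(y_j)/\partial y_i\right)\in M_m(K[[t_1,\dots,t_m]])$, with $i$ the row index and $j$ the column index. $I_m$ is the identity matrix. *)

(* Defs.v *)
From HB Require Import structures.
From mathcomp Require Import all_boot all_algebra generic_quotient.
From mathcomp Require Import boolp mpoly ring.

Set Implicit Arguments.
Unset Strict Implicit.
Unset Printing Implicit Defensive.

Import GRing.Theory.
Local Open Scope ring_scope.
Local Open Scope quotient_scope.

Reserved Notation "[ 'lie' x , y ]" (at level 0, x, y at level 99,
  format "[ 'lie'  x ,  y ]").

HB.mixin Record Lmodule_isLie (K : fieldType) V of GRing.Lmodule K V := {
  lie : V -> V -> V;
  lieDl : forall x y z, lie (x + y) z = lie x z + lie y z;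
  lieDr : forall x y z, lie x (y + z) = lie x y + lie x z;
  lieZl : forall (a : K) x y, lie (a *: x) y = a *: lie x y;
  lieZr : forall (a : K) x y, lie x (a *: y) = a *: lie x y;
  liexx : forall x, lie x x = 0;
  lie_jacobi : forall x y z,
    lie x (lie y z) + lie y (lie z x) + lie z (lie x y) = 0
}.

#[short(type="lieType")]
HB.structure Definition Lie (K : fieldType) :=
  { V of GRing.Lmodule K V & Lmodule_isLie K V }.

Notation "[ 'lie' x , y ]" := (lie x y) : ring_scope.

Section LieTheory.
Variables (K : fieldType) (V : lieType K).
Implicit Types x y z : V.

(* The operator [u (ad v) = [u, v]], usually written on the right. *)
Definition ad v : V -> V := fun u => [lie u, v].

Definition lie_hom (W : lieType K) (phi : V -> W) : Prop :=
  linear phi /\ forall x y, phi [lie x, y] = [lie phi x, phi y].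

Inductive in_span (P : V -> Prop) : V -> Prop :=
| in_span0 : in_span P 0
| in_spanS a x y : P x -> in_span P y -> in_span P (a *: x + y).

Definition derived (P : V -> Prop) : V -> Prop :=
  in_span (fun z => exists x y, [/\ P x, P y & z = [lie x, y]]).

Definition derived1 : V -> Prop := derived (fun _ => True).
Definition derived2 : V -> Prop := derived derived1.

Lemma lie0l x : [lie 0, x] = 0.
Proof. by rewrite -[X in lie X](scale0r x) lieZl scale0r. Qed.
Lemma lie0r x : [lie x, 0] = 0.
Proof. by rewrite -[X in lie _ X](scale0r x) lieZr scale0r. Qed.
Lemma lieNl x y : [lie - x, y] = - [lie x, y].
Proof. by rewrite -scaleN1r lieZl scaleN1r. Qed.
Lemma lieNr x y : [lie x, - y] = - [lie x, y].
Proof. by rewrite -scaleN1r lieZr scaleN1r. Qed.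
Lemma lieC x y : [lie x, y] = - [lie y, x].
Proof.
apply/eqP; rewrite -addr_eq0; apply/eqP.
by have := liexx (x + y); rewrite lieDl !lieDr !liexx add0r addr0.
Qed.
Lemma lieBl x y z : [lie x - y, z] = [lie x, z] - [lie y, z].
Proof. by rewrite lieDl lieNl. Qed.
Lemma lieBr x y z : [lie x, y - z] = [lie x, y] - [lie x, z].
Proof. by rewrite lieDr lieNr. Qed.
Lemma lie_suml I (r : seq I) (P : pred I) (F : I -> V) x :
  [lie \sum_(i <- r | P i) F i, x] = \sum_(i <- r | P i) [lie F i, x].
Proof. by apply: (big_morph (fun y => [lie y, x]) _ (lie0l x)) => y z; exact: lieDl. Qed.
Lemma lie_sumr I (r : seq I) (P : pred I) (F : I -> V) x :
  [lie x, \sum_(i <- r | P i) F i] = \sum_(i <- r | P i) [lie x, F i].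
Proof. by apply: (big_morph (fun y => [lie x, y]) _ (lie0r x)) => y z; exact: lieDr. Qed.

Lemma lie_der x y z : [lie [lie x, y], z] = [lie [lie x, z], y] + [lie x, [lie y, z]].
Proof.
have := lie_jacobi x y z.
rewrite (lieC z [lie x, y]) (lieC z x) (lieC y (- _)) lieNl opprK.
by move/eqP; rewrite subr_eq0 addrC => /eqP ->.
Qed.

Lemma in_span1 (P : V -> Prop) x : P x -> in_span P x.
Proof. by move=> Px; rewrite -[x]addr0 -[x]scale1r; apply: in_spanS => //; exact: in_span0. Qed.

Lemma in_spanD (P : V -> Prop) x y : in_span P x -> in_span P y -> in_span P (x + y).
Proof.
by elim=> [|a u v Pu _ IH] Py; rewrite ?add0r // -addrA; apply: in_spanS => //; exact: IH.
Qed.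

Lemma in_spanZ (P : V -> Prop) a x : in_span P x -> in_span P (a *: x).
Proof.
elim=> [|b u v Pu _ IH]; first by rewrite scaler0; exact: in_span0.
by rewrite scalerDr scalerA; apply: in_spanS.
Qed.

Lemma in_spanN (P : V -> Prop) x : in_span P x -> in_span P (- x).
Proof. by rewrite -scaleN1r; exact: in_spanZ. Qed.

Lemma in_span_sum (P : V -> Prop) I (r : seq I) (Q : pred I) (F : I -> V) :
  (forall i, Q i -> in_span P (F i)) -> in_span P (\sum_(i <- r | Q i) F i).
Proof. by move=> PF; elim/big_ind: _ => //; [exact: in_span0 | exact: in_spanD]. Qed.

Lemma derived2_ideall x y : derived2 x -> derived2 [lie x, y].
Proof.
have d1 u v : derived1 [lie u, v] by apply: in_span1; exists u, v.
elim=> [|a _ v [p [q [Pp Pq ->]]] _ IH]; first by rewrite lie0l; exact: in_span0.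
rewrite lieDl lieZl; apply: in_spanD => //; apply: in_spanZ; rewrite lie_der.
by apply: in_spanD; apply: in_span1; [exists [lie p, y], q | exists p, [lie q, y]].
Qed.

Lemma derived2_idealr x y : derived2 y -> derived2 [lie x, y].
Proof. by move=> Dy; rewrite lieC; apply/in_spanN/derived2_ideall. Qed.
End LieTheory.


Section FormalSums.
Variables (V A : zmodType) (I : Type) (coord : V -> I -> A).

(* Convergence in the formal power series topology: each coordinate of the *)
(* partial sums is eventually constant. As only finitely many coordinates have *)
(* degree below a given bound, this is convergence modulo elements of *)
(* arbitrarily high order. *)
Definition sums_to (v : nat -> V) (s : V) : Prop :=
  forall i, exists N, forall M, (N <= M)%N ->
    coord (\sum_(k < M) v k) i = coord s i.

(* The sum of a convergent series; [0] (junk) if the series does not converge. *)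
Definition fsum (v : nat -> V) : V :=
  if pselect (exists s, sums_to v s) is left cvg then sval (cid cvg) else 0.

Lemma fsum_eq v s : (forall x y, coord x =1 coord y -> x = y) ->
  sums_to v s -> fsum v = s.
Proof.
move=> coord_inj vs; rewrite /fsum; case: pselect => [cvg|[]]; last by exists s.
apply: coord_inj => i; have [N1 h1] := svalP (cid cvg) i; have [N2 h2] := vs i.
by rewrite -(h1 (maxn N1 N2)) ?leq_maxl // h2 ?leq_maxr.
Qed.
End FormalSums.

Section PowerSeries.
Variables (K : fieldType) (m : nat).

(* [K[[t_1, ..., t_m]]]: a series is its family of coefficients. *)
Record powser := PowSer { pcoef : 'X_{1..m} -> K }.

HB.instance Definition _ := gen_eqMixin powser.
HB.instance Definition _ := gen_choiceMixin powser.

Implicit Types f g h : powser.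

Lemma powserP f g : pcoef f =1 pcoef g -> f = g.
Proof. by case: f g => [f] [g] /= /funext ->. Qed.

Definition ps0 := PowSer (fun=> 0).
Definition psadd f g := PowSer (fun a => pcoef f a + pcoef g a).
Definition psopp f := PowSer (fun a => - pcoef f a).
Definition psscale (c : K) f := PowSer (fun a => c * pcoef f a).

Fact psaddA : associative psadd.
Proof. by move=> f g h; apply: powserP => a /=; rewrite addrA. Qed.
Fact psaddC : commutative psadd.
Proof. by move=> f g; apply: powserP => a /=; rewrite addrC. Qed.
Fact psadd0 : left_id ps0 psadd.
Proof. by move=> f; apply: powserP => a /=; rewrite add0r. Qed.
Fact psaddN : left_inverse ps0 psopp psadd.
Proof. by move=> f; apply: powserP => a /=; rewrite addNr. Qed.
HB.instance Definition _ := GRing.isZmodule.Build powser psaddA psaddC psadd0 psaddN.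

Definition ps1 := PowSer (fun a => (a == 0%MM)%:R).
Definition psmul f g := PowSer (fun a =>
  \sum_(b : 'X_{1..m < (mdeg a).+1, (mdeg a).+1} | a == (b.1 + b.2)%MM)
     pcoef f b.1 * pcoef g b.2).

Definition ps_of_mpoly (p : {mpoly K[m]}) : powser := PowSer (fun a => p@_a).
Definition ps_trunc d f : {mpoly K[m]} :=
  \sum_(a : 'X_{1..m < d}) pcoef f a *: 'X_[a].

Fact ps_truncE d f a : (mdeg a < d)%N -> (ps_trunc d f)@_a = pcoef f a.
Proof. by move=> ad; rewrite mcoeff_mpoly. Qed.

Fact psmulE d f g a : (mdeg a < d)%N ->
  pcoef (psmul f g) a = (ps_trunc d f * ps_trunc d g)@_a.
Proof.
move=> ad; rewrite mcoeffM; apply: eq_bigr => -[b1 b2] _ /=.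
by rewrite !ps_truncE // (leq_ltn_trans _ ad) // -ltnS bmdeg.
Qed.

Fact psmulA : associative psmul.
Proof.
move=> f g h; apply: powserP => a.
pose d := (mdeg a).+1; rewrite !(@psmulE d) //.
transitivity (ps_trunc d f * (ps_trunc d g * ps_trunc d h))@_a.
  rewrite !mcoeffM; apply: eq_bigr => b _; congr (_ * _).
  by rewrite ps_truncE ?bmdeg // (@psmulE d) ?bmdeg.
rewrite mulrA !mcoeffM; apply: eq_bigr => b _; congr (_ * _).
by rewrite ps_truncE ?bmdeg // (@psmulE d) ?bmdeg.
Qed.
Fact psmulC : commutative psmul.
Proof. by move=> f g; apply: powserP => a; rewrite !(@psmulE (mdeg a).+1) // mulrC. Qed.
Fact psmul1 : left_id ps1 psmul.
Proof.
move=> f; apply: powserP => a; pose d := (mdeg a).+1.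
rewrite (@psmulE d) //; suff -> : ps_trunc d ps1 = 1 by rewrite mul1r ps_truncE.
apply/mpolyP => b; have [bd|bd] := ltnP (mdeg b) d.
  by rewrite ps_truncE //= mcoeff1.
rewrite mcoeff1 raddf_sum /= big1; last first.
  move=> k _; rewrite mcoeffZ mcoeffX; case: (bmnm k =P b) => [kb|_]; rewrite ?mulr0 //.
  by move: bd; rewrite -kb leqNgt bmdeg.
by case: eqP => // b0; move: bd; rewrite b0 mdeg0.
Qed.
Fact psmulDl : left_distributive psmul psadd.
Proof.
move=> f g h; apply: powserP => a /=; rewrite -big_split.
by apply: eq_bigr => b _; rewrite mulrDl.
Qed.
Fact ps1_neq0 : ps1 != 0.
Proof. by apply/eqP => /(congr1 (fun f => pcoef f 0%MM)) /eqP; rewrite /= eqxx oner_eq0. Qed.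
HB.instance Definition _ := GRing.Zmodule_isComNzRing.Build powser
  psmulA psmulC psmul1 psmulDl ps1_neq0.

Fact psscaleA a b f : psscale a (psscale b f) = psscale (a * b) f.
Proof. by apply: powserP => k /=; rewrite mulrA. Qed.
Fact psscale1 : left_id 1 psscale.
Proof. by move=> f; apply: powserP => k /=; rewrite mul1r. Qed.
Fact psscaleDr : right_distributive psscale +%R.
Proof. by move=> a f g; apply: powserP => k /=; rewrite mulrDr. Qed.
Fact psscaleDl f : {morph psscale^~ f : a b / a + b}.
Proof. by move=> a b; apply: powserP => k /=; rewrite mulrDl. Qed.
HB.instance Definition _ := GRing.Zmodule_isLmodule.Build K powser
  psscaleA psscale1 psscaleDr psscaleDl.
Fact psscaleAl (a : K) f g : a *: (f * g) = a *: f * g.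
Proof.
apply: powserP => k /=; rewrite mulr_sumr.
by apply: eq_bigr => b _; rewrite mulrA.
Qed.
HB.instance Definition _ := GRing.Lmodule_isLalgebra.Build K powser psscaleAl.
HB.instance Definition _ := GRing.Lalgebra_isComAlgebra.Build K powser.

Definition psvar (i : 'I_m) : powser := ps_of_mpoly 'X_i.

Definition psum : (nat -> powser) -> powser := fsum pcoef.

(* [f] lies in [K[[t_q, ..., t_m]]]. *)
Definition vars_from (q : 'I_m) f : Prop :=
  forall (a : 'X_{1..m}) (i : 'I_m), (i < q)%N -> (0 < a i)%N -> pcoef f a = 0.
End PowerSeries.

(* The abelian wreath product [C + B]: [C] (first component) is the free *)
(* [R]-module on the [a_i] and [B] (second component) has basis the [b_j], which *)
(* act on [C] through the elements [t j] of [R]. *)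
Definition wreath (K : fieldType) (m : nat) (R : comAlgType K) (t : 'I_m -> R)
  : Type := ({ffun 'I_m -> R} * {ffun 'I_m -> K^o})%type.

Section Wreath.
Variables (K : fieldType) (m : nat) (R : comAlgType K) (t : 'I_m -> R).
Local Notation W := (wreath t).
HB.instance Definition _ := GRing.Lmodule.on W.
Implicit Types u v w : W.

Definition wact (b : {ffun 'I_m -> K^o}) : R := \sum_j (b j : K) *: t j.
Definition wlie u v : W :=
  ([ffun i => u.1 i * wact v.2 - v.1 i * wact u.2], 0).

Fact wactD b c : wact (b + c) = wact b + wact c.
Proof. by rewrite -big_split; apply: eq_bigr => j _; rewrite ffunE scalerDl. Qed.
Fact wactZ (a : K) b : wact (a *: b) = a *: wact b.
Proof. by rewrite scaler_sumr; apply: eq_bigr => j _; rewrite ffunE scalerA. Qed.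
Fact wact0 : wact 0 = 0.
Proof. by rewrite /wact big1 // => j _; rewrite ffunE scale0r. Qed.

Fact wlieDl u v w : wlie (u + v) w = wlie u w + wlie v w.
Proof.
congr pair; last by rewrite addr0.
by apply/ffunP => i; rewrite !ffunE /= wactD mulrDl mulrDr opprD addrACA.
Qed.
Fact wlieC u v : wlie u v = - wlie v u.
Proof.
by congr pair; rewrite ?oppr0 //; apply/ffunP => i; rewrite !ffunE opprB.
Qed.
Fact wlieZl (a : K) u v : wlie (a *: u) v = a *: wlie u v.
Proof.
congr pair; last by rewrite scaler0.
by apply/ffunP => i; rewrite !ffunE /= wactZ -scalerAl -scalerAr scalerBr.
Qed.
Fact wlieDr u v w : wlie u (v + w) = wlie u v + wlie u w.
Proof. by rewrite wlieC wlieDl opprD -!(wlieC u). Qed.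
Fact wlieZr (a : K) u v : wlie u (a *: v) = a *: wlie u v.
Proof. by rewrite wlieC wlieZl -scalerN -(wlieC u). Qed.
Fact wliexx u : wlie u u = 0.
Proof. by congr pair; apply/ffunP => i; rewrite !ffunE subrr. Qed.
Fact wlie_jacobi u v w : wlie u (wlie v w) + wlie v (wlie w u) + wlie w (wlie u v) = 0.
Proof.
congr pair; last by rewrite /= !addr0.
apply/ffunP => i; rewrite !ffunE /= wact0; ring.
Qed.
HB.instance Definition _ :=
  Lmodule_isLie.Build K W wlieDl wlieDr wlieZl wlieZr wliexx wlie_jacobi.
End Wreath.

Section FreeLie.
Variables (K : fieldType) (m : nat).

Inductive lterm :=
| LVar of 'I_m
| LZero
| LAdd of lterm & lterm
| LScale of K & lterm
| LBr of lterm & lterm.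

HB.instance Definition _ := gen_eqMixin lterm.
HB.instance Definition _ := gen_choiceMixin lterm.

(* The congruence generated by the axioms of Lie algebras over [K]; the opposite *)
(* of [a] is [(-1) a]. *)
Inductive lcongr : lterm -> lterm -> Prop :=
| lc_refl a : lcongr a a
| lc_sym a b : lcongr a b -> lcongr b a
| lc_trans b a c : lcongr a b -> lcongr b c -> lcongr a c
| lc_add a a' b b' : lcongr a a' -> lcongr b b' -> lcongr (LAdd a b) (LAdd a' b')
| lc_scale k a a' : lcongr a a' -> lcongr (LScale k a) (LScale k a')
| lc_br a a' b b' : lcongr a a' -> lcongr b b' -> lcongr (LBr a b) (LBr a' b')
| lc_addA a b c : lcongr (LAdd a (LAdd b c)) (LAdd (LAdd a b) c)
| lc_addC a b : lcongr (LAdd a b) (LAdd b a)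
| lc_add0 a : lcongr (LAdd LZero a) a
| lc_addN a : lcongr (LAdd (LScale (-1) a) a) LZero
| lc_scaleA k l a : lcongr (LScale k (LScale l a)) (LScale (k * l) a)
| lc_scale1 a : lcongr (LScale 1 a) a
| lc_scaleDr k a b : lcongr (LScale k (LAdd a b)) (LAdd (LScale k a) (LScale k b))
| lc_scaleDl k l a : lcongr (LScale (k + l) a) (LAdd (LScale k a) (LScale l a))
| lc_brDl a b c : lcongr (LBr (LAdd a b) c) (LAdd (LBr a c) (LBr b c))
| lc_brDr a b c : lcongr (LBr a (LAdd b c)) (LAdd (LBr a b) (LBr a c))
| lc_brZl k a b : lcongr (LBr (LScale k a) b) (LScale k (LBr a b))
| lc_brZr k a b : lcongr (LBr a (LScale k b)) (LScale k (LBr a b))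
| lc_brxx a : lcongr (LBr a a) LZero
| lc_jacobi a b c :
    lcongr (LAdd (LAdd (LBr a (LBr b c)) (LBr b (LBr c a))) (LBr c (LBr a b))) LZero.

Definition lequiv (a b : lterm) : bool := `[< lcongr a b >].
Fact lequiv_refl : reflexive lequiv.
Proof. by move=> a; apply/asboolP; exact: lc_refl. Qed.
Fact lequiv_sym : ssrbool.symmetric lequiv.
Proof. by move=> a b; apply/asboolP/asboolP; exact: lc_sym. Qed.
Fact lequiv_trans : transitive lequiv.
Proof. by move=> b a c /asboolP ab /asboolP bc; apply/asboolP; exact: lc_trans bc. Qed.
Canonical lequiv_rel := EquivRel lequiv lequiv_refl lequiv_sym lequiv_trans.

(* The free Lie algebra [L_m] on [x_1, ..., x_m]. *)
Definition freeLie : Type := {eq_quot lequiv}.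
HB.instance Definition _ := Choice.on freeLie.
HB.instance Definition _ : EqQuotient _ lequiv freeLie := EqQuotient.on freeLie.

Definition lclass (a : lterm) : freeLie := \pi_freeLie a.

Lemma lclassP a b : lclass a = lclass b <-> lcongr a b.
Proof.
split=> [/eqP|ab]; first by rewrite eqmodE => /asboolP.
by apply/eqP; rewrite eqmodE; apply/asboolP.
Qed.

Lemma lreprK (x : freeLie) : lclass (repr x) = x.
Proof. exact: reprK. Qed.

Lemma lclass_ind (P : freeLie -> Prop) : (forall a, P (lclass a)) -> forall x, P x.
Proof. by move=> h x; rewrite -(lreprK x). Qed.

Definition fladd (x y : freeLie) := lclass (LAdd (repr x) (repr y)).
Definition flscale (k : K) (x : freeLie) := lclass (LScale k (repr x)).
Definition flbr (x y : freeLie) := lclass (LBr (repr x) (repr y)).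

Fact repr_lclass a : lcongr (repr (lclass a)) a.
Proof. by apply/lclassP; exact: lreprK. Qed.

Fact fladdE a b : fladd (lclass a) (lclass b) = lclass (LAdd a b).
Proof. by apply/lclassP; apply: lc_add; exact: repr_lclass. Qed.
Fact flscaleE k a : flscale k (lclass a) = lclass (LScale k a).
Proof. by apply/lclassP; apply: lc_scale; exact: repr_lclass. Qed.
Fact flbrE a b : flbr (lclass a) (lclass b) = lclass (LBr a b).
Proof. by apply/lclassP; apply: lc_br; exact: repr_lclass. Qed.

Fact fladdA : associative fladd.
Proof.
move=> x y z; elim/lclass_ind: x => a; elim/lclass_ind: y => b; elim/lclass_ind: z => c.
by rewrite !fladdE; apply/lclassP; exact: lc_addA.
Qed.
Fact fladdC : commutative fladd.
Proof.
move=> x y; elim/lclass_ind: x => a; elim/lclass_ind: y => b.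
by rewrite !fladdE; apply/lclassP; exact: lc_addC.
Qed.
Fact fladd0 : left_id (lclass LZero) fladd.
Proof.
move=> x; elim/lclass_ind: x => a.
by rewrite !fladdE; apply/lclassP; exact: lc_add0.
Qed.
Fact fladdN : left_inverse (lclass LZero) (flscale (-1)) fladd.
Proof.
move=> x; elim/lclass_ind: x => a.
by rewrite flscaleE fladdE; apply/lclassP; exact: lc_addN.
Qed.
HB.instance Definition _ := GRing.isZmodule.Build freeLie fladdA fladdC fladd0 fladdN.

Fact flscaleA k l x : flscale k (flscale l x) = flscale (k * l) x.
Proof.
elim/lclass_ind: x => a.
by rewrite !flscaleE; apply/lclassP; exact: lc_scaleA.
Qed.
Fact flscale1 : left_id 1 flscale.
Proof.
move=> x; elim/lclass_ind: x => a.
by rewrite !flscaleE; apply/lclassP; exact: lc_scale1.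
Qed.
Fact flscaleDr : right_distributive flscale +%R.
Proof.
move=> k x y; elim/lclass_ind: x => a; elim/lclass_ind: y => b.
rewrite [lclass a + _]fladdE !flscaleE [RHS]fladdE.
by apply/lclassP; exact: lc_scaleDr.
Qed.
Fact flscaleDl x : {morph flscale^~ x : k l / k + l}.
Proof.
move=> k l; elim/lclass_ind: x => a; rewrite !flscaleE [RHS]fladdE.
by apply/lclassP; exact: lc_scaleDl.
Qed.
HB.instance Definition _ := GRing.Zmodule_isLmodule.Build K freeLie
  flscaleA flscale1 flscaleDr flscaleDl.

Fact flbrDl x y z : flbr (x + y) z = flbr x z + flbr y z.
Proof.
elim/lclass_ind: x => a; elim/lclass_ind: y => b; elim/lclass_ind: z => c.
rewrite [lclass a + _]fladdE !flbrE [RHS]fladdE; apply/lclassP; exact: lc_brDl.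
Qed.
Fact flbrDr x y z : flbr x (y + z) = flbr x y + flbr x z.
Proof.
elim/lclass_ind: x => a; elim/lclass_ind: y => b; elim/lclass_ind: z => c.
rewrite [lclass b + _]fladdE !flbrE [RHS]fladdE; apply/lclassP; exact: lc_brDr.
Qed.
Fact flbrZl (k : K) x y : flbr (k *: x) y = k *: flbr x y.
Proof.
elim/lclass_ind: x => a; elim/lclass_ind: y => b.
rewrite [k *: lclass a]flscaleE !flbrE [RHS]flscaleE; apply/lclassP; exact: lc_brZl.
Qed.
Fact flbrZr (k : K) x y : flbr x (k *: y) = k *: flbr x y.
Proof.
elim/lclass_ind: x => a; elim/lclass_ind: y => b.
rewrite [k *: lclass b]flscaleE !flbrE [RHS]flscaleE; apply/lclassP; exact: lc_brZr.
Qed.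
Fact flbrxx x : flbr x x = 0.
Proof.
by elim/lclass_ind: x => a; rewrite flbrE; apply/lclassP; exact: lc_brxx.
Qed.
Fact flbr_jacobi x y z : flbr x (flbr y z) + flbr y (flbr z x) + flbr z (flbr x y) = 0.
Proof.
elim/lclass_ind: x => a; elim/lclass_ind: y => b; elim/lclass_ind: z => c.
rewrite !flbrE [X in X + _]fladdE [LHS]fladdE; apply/lclassP; exact: lc_jacobi.
Qed.
HB.instance Definition _ := Lmodule_isLie.Build K freeLie
  flbrDl flbrDr flbrZl flbrZr flbrxx flbr_jacobi.

Definition flgen (i : 'I_m) : freeLie := lclass (LVar i).

Variables (V : lieType K) (g : 'I_m -> V).

Fixpoint leval (a : lterm) : V :=
  match a with
  | LVar i => g i
  | LZero => 0
  | LAdd a b => leval a + leval b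
  | LScale k a => k *: leval a
  | LBr a b => [lie leval a, leval b]
  end.

Lemma leval_congr a b : lcongr a b -> leval a = leval b.
Proof.
elim=> //= {a b}.
- by move=> b a c _ -> _ ->.
- by move=> a a' b b' _ -> _ ->.
- by move=> k a a' _ ->.
- by move=> a a' b b' _ -> _ ->.
- by move=> a b c; rewrite addrA.
- by move=> a b; rewrite addrC.
- by move=> a; rewrite add0r.
- by move=> a; rewrite scaleN1r addNr.
- by move=> k l a; rewrite scalerA.
- by move=> a; rewrite scale1r.
- by move=> k a b; rewrite scalerDr.
- by move=> k l a; rewrite scalerDl.
- by move=> a b c; rewrite lieDl.
- by move=> a b c; rewrite lieDr.
- by move=> k a b; rewrite lieZl.
- by move=> k a b; rewrite lieZr.
- by move=> a; rewrite liexx.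
- by move=> a b c; rewrite lie_jacobi.
Qed.

(* The homomorphism [L_m -> V] with [x_i |-> g i]. *)
Definition freeLie_lift (x : freeLie) : V := leval (repr x).

Lemma freeLie_liftE a : freeLie_lift (lclass a) = leval a.
Proof. exact/leval_congr/repr_lclass. Qed.

Lemma freeLie_lift_gen i : freeLie_lift (flgen i) = g i.
Proof. exact: freeLie_liftE. Qed.

Lemma freeLie_lift_hom : lie_hom freeLie_lift.
Proof.
split=> [k x y|x y]; elim/lclass_ind: x => a; elim/lclass_ind: y => b.
  by rewrite [k *: _]flscaleE [_ + _]fladdE !freeLie_liftE.
by rewrite [lie _ _]flbrE !freeLie_liftE.
Qed.
End FreeLie.

Section FreeMetabelian.
Variables (K : fieldType) (m : nat).
Local Notation L := (freeLie K m).

Definition fmequiv (x y : L) : bool := `[< derived2 (x - y) >].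
Fact fmequiv_refl : reflexive fmequiv.
Proof. by move=> x; apply/asboolP; rewrite subrr; exact: in_span0. Qed.
Fact fmequiv_sym : ssrbool.symmetric fmequiv.
Proof.
by move=> x y; apply/asboolP/asboolP => h; rewrite -opprB; exact: in_spanN.
Qed.
Fact fmequiv_trans : transitive fmequiv.
Proof.
move=> y x z /asboolP xy /asboolP yz; apply/asboolP.
by rewrite -(subrKA y); exact: in_spanD.
Qed.
Canonical fmequiv_rel := EquivRel fmequiv fmequiv_refl fmequiv_sym fmequiv_trans.

(* [F_m = L_m / L_m'']. *)
Definition freeMetab : Type := {eq_quot fmequiv}.
HB.instance Definition _ := Choice.on freeMetab.
HB.instance Definition _ : EqQuotient _ fmequiv freeMetab := EqQuotient.on freeMetab.
Local Notation F := freeMetab.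

Definition fmclass (x : L) : F := \pi_freeMetab x.

Lemma fmclassP x y : fmclass x = fmclass y <-> derived2 (x - y).
Proof.
split=> [/eqP|xy]; first by rewrite eqmodE => /asboolP.
by apply/eqP; rewrite eqmodE; apply/asboolP.
Qed.

Lemma fmreprK (f : F) : fmclass (repr f) = f.
Proof. exact: reprK. Qed.

Lemma fmclass_ind (P : F -> Prop) : (forall x, P (fmclass x)) -> forall f, P f.
Proof. by move=> h f; rewrite -(fmreprK f). Qed.

Definition fmadd (f g : F) := fmclass (repr f + repr g).
Definition fmopp (f : F) := fmclass (- repr f).
Definition fmscale (k : K) (f : F) := fmclass (k *: repr f).
Definition fmbr (f g : F) := fmclass [lie repr f, repr g].

Fact repr_fmclass x : derived2 (repr (fmclass x) - x).
Proof. by apply/fmclassP; exact: fmreprK. Qed.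

Fact fmaddE x y : fmadd (fmclass x) (fmclass y) = fmclass (x + y).
Proof.
by apply/fmclassP; rewrite opprD addrACA; apply: in_spanD; exact: repr_fmclass.
Qed.
Fact fmoppE x : fmopp (fmclass x) = fmclass (- x).
Proof. by apply/fmclassP; rewrite -opprD; apply/in_spanN/repr_fmclass. Qed.
Fact fmscaleE k x : fmscale k (fmclass x) = fmclass (k *: x).
Proof. by apply/fmclassP; rewrite -scalerBr; apply/in_spanZ/repr_fmclass. Qed.
Fact fmbrE x y : fmbr (fmclass x) (fmclass y) = fmclass [lie x, y].
Proof.
apply/fmclassP; rewrite -(subrKA [lie x, repr (fmclass y)]) -lieBl -lieBr.
apply: in_spanD; first exact/derived2_ideall/repr_fmclass.
exact/derived2_idealr/repr_fmclass.
Qed.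

Fact fmaddA : associative fmadd.
Proof.
move=> f g h; elim/fmclass_ind: f => x; elim/fmclass_ind: g => y; elim/fmclass_ind: h => z.
by rewrite !fmaddE addrA.
Qed.
Fact fmaddC : commutative fmadd.
Proof.
by move=> f g; elim/fmclass_ind: f => x; elim/fmclass_ind: g => y; rewrite !fmaddE addrC.
Qed.
Fact fmadd0 : left_id (fmclass 0) fmadd.
Proof. by move=> f; elim/fmclass_ind: f => x; rewrite fmaddE add0r. Qed.
Fact fmaddN : left_inverse (fmclass 0) fmopp fmadd.
Proof. by move=> f; elim/fmclass_ind: f => x; rewrite fmoppE fmaddE addNr. Qed.
HB.instance Definition _ := GRing.isZmodule.Build freeMetab fmaddA fmaddC fmadd0 fmaddN.

Fact fmscaleA k l f : fmscale k (fmscale l f) = fmscale (k * l) f.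
Proof. by elim/fmclass_ind: f => x; rewrite !fmscaleE scalerA. Qed.
Fact fmscale1 : left_id 1 fmscale.
Proof. by move=> f; elim/fmclass_ind: f => x; rewrite fmscaleE scale1r. Qed.
Fact fmscaleDr : right_distributive fmscale +%R.
Proof.
move=> k f g; elim/fmclass_ind: f => x; elim/fmclass_ind: g => y.
by rewrite [fmclass x + _]fmaddE !fmscaleE [RHS]fmaddE scalerDr.
Qed.
Fact fmscaleDl f : {morph fmscale^~ f : k l / k + l}.
Proof.
by move=> k l; elim/fmclass_ind: f => x; rewrite !fmscaleE [RHS]fmaddE scalerDl.
Qed.
HB.instance Definition _ := GRing.Zmodule_isLmodule.Build K freeMetab
  fmscaleA fmscale1 fmscaleDr fmscaleDl.

Fact fmbrDl f g h : fmbr (f + g) h = fmbr f h + fmbr g h.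
Proof.
elim/fmclass_ind: f => x; elim/fmclass_ind: g => y; elim/fmclass_ind: h => z.
by rewrite [fmclass x + _]fmaddE !fmbrE [RHS]fmaddE lieDl.
Qed.
Fact fmbrDr f g h : fmbr f (g + h) = fmbr f g + fmbr f h.
Proof.
elim/fmclass_ind: f => x; elim/fmclass_ind: g => y; elim/fmclass_ind: h => z.
by rewrite [fmclass y + _]fmaddE !fmbrE [RHS]fmaddE lieDr.
Qed.
Fact fmbrZl (k : K) f g : fmbr (k *: f) g = k *: fmbr f g.
Proof.
elim/fmclass_ind: f => x; elim/fmclass_ind: g => y.
by rewrite [k *: fmclass x]fmscaleE !fmbrE [RHS]fmscaleE lieZl.
Qed.
Fact fmbrZr (k : K) f g : fmbr f (k *: g) = k *: fmbr f g.
Proof.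
elim/fmclass_ind: f => x; elim/fmclass_ind: g => y.
by rewrite [k *: fmclass y]fmscaleE !fmbrE [RHS]fmscaleE lieZr.
Qed.
Fact fmbrxx f : fmbr f f = 0.
Proof. by elim/fmclass_ind: f => x; rewrite fmbrE liexx. Qed.
Fact fmbr_jacobi f g h : fmbr f (fmbr g h) + fmbr g (fmbr h f) + fmbr h (fmbr f g) = 0.
Proof.
elim/fmclass_ind: f => x; elim/fmclass_ind: g => y; elim/fmclass_ind: h => z.
by rewrite !fmbrE [X in X + _]fmaddE [LHS]fmaddE lie_jacobi.
Qed.
HB.instance Definition _ := Lmodule_isLie.Build K freeMetab
  fmbrDl fmbrDr fmbrZl fmbrZr fmbrxx fmbr_jacobi.

Definition fmgen (i : 'I_m) : F := fmclass (flgen K i).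

Section Lift.
Variables (V : lieType K) (g : 'I_m -> V).
Hypothesis V_metab : forall a b c d : V, [lie [lie a, b], [lie c, d]] = 0.

(* For metabelian [V], the homomorphism [F_m -> V] with [y_i |-> g i]. *)
Definition freeMetab_lift (f : F) : V := freeLie_lift g (repr f).

Lemma freeLie_lift_derived2 x : derived2 x -> freeLie_lift g x = 0.
Proof.
have [lin br] := freeLie_lift_hom g.
have lift0 : freeLie_lift g 0 = 0 by exact: freeLie_liftE.
elim=> // a _ y [p [q [Pp Pq ->]]] _ IH; rewrite lin IH addr0 br.
have h z : derived1 z -> in_span (fun w => exists a b : V, w = [lie a, b]) (freeLie_lift g z).
  elim=> [|b _ t [u [v [_ _ ->]]] _ IHz]; first by rewrite lift0; exact: in_span0.
  by rewrite lin br; apply: in_spanS IHz; do 2!eexists.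
elim: (h _ Pp) => [|b _ z [u [v ->]] _ IHz]; first by rewrite lie0l scaler0.
rewrite lieDl lieZl scalerDr IHz addr0.
elim: (h _ Pq) => [|b' _ z' [u' [v' ->]] _ IHz']; first by rewrite lie0r !scaler0.
by rewrite lieDr lieZr V_metab scaler0 add0r.
Qed.

Lemma freeMetab_liftE x : freeMetab_lift (fmclass x) = freeLie_lift g x.
Proof.
have [lin _] := freeLie_lift_hom g; have := freeLie_lift_derived2 (repr_fmclass x).
by rewrite addrC -scaleN1r lin scaleN1r addrC => /eqP; rewrite subr_eq0 => /eqP.
Qed.

Lemma freeMetab_lift_gen i : freeMetab_lift (fmgen i) = g i.
Proof. by rewrite freeMetab_liftE freeLie_lift_gen. Qed.

Lemma freeMetab_lift_hom : lie_hom freeMetab_lift.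
Proof.
have [lin br] := freeLie_lift_hom g.
split=> [k x y|x y]; elim/fmclass_ind: x => x; elim/fmclass_ind: y => y.
  by rewrite [k *: _]fmscaleE [_ + _]fmaddE !freeMetab_liftE lin.
by rewrite [lie _ _]fmbrE !freeMetab_liftE br.
Qed.
End Lift.

(* [monomial d f]: [f] is a Lie monomial of degree [d] in the generators. *)
Inductive monomial : nat -> F -> Prop :=
| mono_gen i : monomial 1 (fmgen i)
| mono_br d e f g : monomial d f -> monomial e g -> monomial (d + e) [lie f, g].

Definition homogeneous (d : nat) : F -> Prop := in_span (monomial d).

Lemma homogeneous_br d e f g : homogeneous d f -> homogeneous e g -> homogeneous (d + e) [lie f, g].
Proof.
move=> hf hg; elim: hf => [|a x y Mx _ IH]; first by rewrite lie0l; exact: in_span0.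
rewrite lieDl lieZl; apply: in_spanD => //; apply: in_spanZ.
elim: hg => [|b z t Mz _ IHz]; first by rewrite lie0r; exact: in_span0.
rewrite lieDr lieZr; apply: in_spanD => //; apply/in_spanZ/in_span1.
exact: mono_br.
Qed.

Lemma homogeneous0 f : homogeneous 0 f -> f = 0.
Proof.
have mono_gt0 d g : monomial d g -> (0 < d)%N.
  by elim=> // p q ? ? _ p0 _ _; rewrite addn_gt0 p0.
by elim=> // a x y /mono_gt0.
Qed.
End FreeMetabelian.

Section WreathEmbedding.
Variables (K : fieldType) (m : nat).

(* The generator [a_i + b_i]. *)
Definition wgen (R : comAlgType K) (t : 'I_m -> R) (i : 'I_m) : wreath t :=
  ([ffun j => (j == i)%:R], [ffun j => (j == i)%:R : K]).

Lemma wreath_metab (R : comAlgType K) (t : 'I_m -> R) (a b c d : wreath t) :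
  [lie [lie a, b], [lie c, d]] = 0.
Proof.
congr pair; apply/ffunP => i.
by rewrite !ffunE /= wact0 !mulr0 subrr.
Qed.

Definition polyvar (i : 'I_m) : {mpoly K[m]} := 'X_i.

Definition eps : freeMetab K m -> wreath polyvar :=
  freeMetab_lift (wgen polyvar).

Lemma eps_gen i : eps (fmgen K i) = wgen polyvar i.
Proof. exact/freeMetab_lift_gen/wreath_metab. Qed.

Lemma eps_hom : lie_hom eps.
Proof. exact/freeMetab_lift_hom/wreath_metab. Qed.

(* In degree [d], [eps] takes values in polynomials homogeneous of degree [d-1]. *)
Lemma eps_homogeneous d f : homogeneous d f ->
  (forall i a, ((eps f).1 i)@_a != 0 -> (mdeg a).+1 = d) /\
  (forall i, (eps f).2 i != 0 -> d = 1%N).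
Proof.
have [lin br] := eps_hom.
pose Q d (w : wreath polyvar) := (forall i a, (w.1 i)@_a != 0 -> (mdeg a).+1 = d) /\
  (forall i, w.2 i != 0 -> d = 1%N).
have actP e (g : wreath polyvar) a : Q e g -> (wact polyvar g.2)@_a != 0 -> mdeg a = e.
  move=> [_ Q2]; rewrite raddf_sum /= => nz.
  have /existsP[j]: [exists j, (((g.2 j : K) *: polyvar j)@_a != 0)].
    apply: contraNT nz => /existsPn h; apply/eqP; apply: big1 => j _.
    by apply/eqP; rewrite -[_ == _]negbK h.
  rewrite mcoeffZ mulf_eq0 negb_or => /andP[/Q2 -> ].
  rewrite mcoeffX; case: (U_(j)%MM =P a) => [<-|]; last by rewrite eqxx.
  by rewrite mdeg1.
have mulP e e' (p q : {mpoly K[m]}) a :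
    (forall b, p@_b != 0 -> (mdeg b).+1 = e) -> (forall b, q@_b != 0 -> mdeg b = e') ->
    (p * q)@_a != 0 -> (mdeg a).+1 = (e + e')%N.
  move=> hp hq; rewrite mcoeffM => nz.
  have [[[b b'] /= /eqP ab]|h] := pselect (exists2 b : 'X_{1..m < (mdeg a).+1, (mdeg a).+1},
     a == (b.1 + b.2)%MM & p@_b.1 * q@_b.2 != 0).
    rewrite mulf_eq0 negb_or => /andP[/hp <- /hq <-].
    by rewrite {1}ab mdegD addSn.
  case/eqP: nz; apply: big1 => b ab; apply/eqP; apply: contrapT => /negP nz.
  by apply: h; exists b.
have Qmono e g : monomial e g -> Q e (eps g).
  elim=> [i|{}d {}e u v _ [Qu1 Qu2] _ [Qv1 Qv2]].
    rewrite eps_gen; split=> [j a|j] //=; rewrite ffunE.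
    case: (j == i); rewrite ?mcoeff0 ?mcoeff1 ?eqxx //.
    by case: (a =P 0%MM) => [->|_]; rewrite ?mdeg0 ?eqxx.
  rewrite br; split=> [j a|j]; rewrite /= !ffunE ?eqxx //.
  rewrite mcoeffB subr_eq0 => nz.
  have [nz1|nz1] := boolP (((eps u).1 j * wact polyvar (eps v).2)@_a == 0).
    move: nz; rewrite (eqP nz1) eq_sym => nz; rewrite addnC.
    by apply: (mulP _ _ _ _ _ (Qv1 j)) nz => b; apply: actP.
  by apply: (mulP _ _ _ _ _ (Qu1 j)) nz1 => b; apply: actP.
elim=> [|c u v Mu _ [IH1 IH2]].
  have -> : eps 0 = 0.
    by have := lin (-1) 0 0; rewrite scaler0 addr0 scaleN1r addNr.
  by split=> [i a|i]; rewrite /= ffunE ?mcoeff0 eqxx.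
have [Q1 Q2] := Qmono _ _ Mu; rewrite lin; split=> [i a|i].
  rewrite /= !ffunE mcoeffD mcoeffZ.
  have [->|/Q1 //] := eqVneq ((eps u).1 i)@_a 0; rewrite mulr0 add0r; exact: IH1.
rewrite /= !ffunE.
have [->|/Q2 //] := eqVneq ((eps u).2 i) 0; rewrite scaler0 add0r; exact: IH2.
Qed.
End WreathEmbedding.

Lemma conv_pairs (A : zmodType) (H : nat -> nat -> A) N n : (n < N)%N ->
  \sum_(i < n.+1) H i (n - i)%N =
  \sum_(i < N) \sum_(j < N) if (i + j == n)%N then H i j else 0.
Proof.
move=> nN; rewrite (big_ord_widen N (fun i => H i (n - i)%N)) // big_mkcond /=.
apply: eq_bigr => i _; rewrite ltnS; case: leqP => [le_in|lt_ni].
  have jN : (n - i < N)%N by rewrite (leq_ltn_trans (leq_subr _ _)).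
  rewrite (bigD1 (Ordinal jN)) //= subnKC // eqxx big1 ?addr0 // => j ji.
  case: eqP => // ij; case/eqP: ji; apply: val_inj => /=.
  by rewrite -[X in (X - _)%N]ij addKn.
rewrite big1 // => j _; case: eqP => // ij.
by move: lt_ni; rewrite ltnNge -[X in (_ <= X)%N]ij leq_addr.
Qed.

Section Completion.
Variables (K : fieldType) (m : nat).
Local Notation F := (freeMetab K m).

(* The completion of [F_m]: formal sums [f_0 + f_1 + f_2 + ...] with [f_d] *)
(* homogeneous of degree [d] (so that [f_0 = 0]). *)
Record fmhat := FMHat {
  fcomp : nat -> F;
  fcompP : forall d, homogeneous d (fcomp d)
}.

HB.instance Definition _ := gen_eqMixin fmhat.
HB.instance Definition _ := gen_choiceMixin fmhat.

Implicit Types f g h u v : fmhat.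

Lemma fmhatP f g : fcomp f =1 fcomp g -> f = g.
Proof.
case: f g => [f pf] [g pg] /= /funext fg; case: _ / fg in pg *.
by congr FMHat; exact: Prop_irrelevance.
Qed.

Fact fh0_subproof d : homogeneous d (0 : F). Proof. exact: in_span0. Qed.
Definition fh0 := FMHat fh0_subproof.
Definition fhadd f g :=
  FMHat (fun d => in_spanD (fcompP f d) (fcompP g d)).
Definition fhopp f := FMHat (fun d => in_spanN (fcompP f d)).
Definition fhscale k f := FMHat (fun d => in_spanZ k (fcompP f d)).

Fact fhaddA : associative fhadd.
Proof. by move=> f g h; apply: fmhatP => d /=; rewrite addrA. Qed.
Fact fhaddC : commutative fhadd.
Proof. by move=> f g; apply: fmhatP => d /=; rewrite addrC. Qed.
Fact fhadd0 : left_id fh0 fhadd.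
Proof. by move=> f; apply: fmhatP => d /=; rewrite add0r. Qed.
Fact fhaddN : left_inverse fh0 fhopp fhadd.
Proof. by move=> f; apply: fmhatP => d /=; rewrite addNr. Qed.
HB.instance Definition _ := GRing.isZmodule.Build fmhat fhaddA fhaddC fhadd0 fhaddN.

Fact fhscaleA k l f : fhscale k (fhscale l f) = fhscale (k * l) f.
Proof. by apply: fmhatP => d /=; rewrite scalerA. Qed.
Fact fhscale1 : left_id 1 fhscale.
Proof. by move=> f; apply: fmhatP => d /=; rewrite scale1r. Qed.
Fact fhscaleDr : right_distributive fhscale +%R.
Proof. by move=> k f g; apply: fmhatP => d /=; rewrite scalerDr. Qed.
Fact fhscaleDl f : {morph fhscale^~ f : k l / k + l}.
Proof. by move=> k l; apply: fmhatP => d /=; rewrite scalerDl. Qed.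
HB.instance Definition _ := GRing.Zmodule_isLmodule.Build K fmhat
  fhscaleA fhscale1 fhscaleDr fhscaleDl.

Lemma fcomp_sum I (r : seq I) (P : pred I) (G : I -> fmhat) d :
  fcomp (\sum_(i <- r | P i) G i) d = \sum_(i <- r | P i) fcomp (G i) d.
Proof. by elim/big_rec2: _ => // i x y _ <-. Qed.

Fact fhbr_subproof f g d :
  homogeneous d (\sum_(i < d.+1) [lie fcomp f i, fcomp g (d - i)%N]).
Proof.
apply: in_span_sum => i _; rewrite -{1}(subnKC (leq_ord i)).
exact/homogeneous_br/fcompP/fcompP.
Qed.
Definition fhbr f g := FMHat (fhbr_subproof f g).

Fact fhbrDl f g h : fhbr (f + g) h = fhbr f h + fhbr g h.
Proof.
by apply: fmhatP => d; rewrite /= -big_split; apply: eq_bigr => i _; rewrite lieDl.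
Qed.
Fact fhbrZl (k : K) f g : fhbr (k *: f) g = k *: fhbr f g.
Proof.
by apply: fmhatP => d; rewrite /= scaler_sumr; apply: eq_bigr => i _; rewrite lieZl.
Qed.
Fact fhbrC f g : fhbr f g = - fhbr g f.
Proof.
apply: fmhatP => d; rewrite /= -sumrN (reindex_inj rev_ord_inj) /=.
by apply: eq_bigr => i _; rewrite subSS subKn ?leq_ord // -lieC.
Qed.
Fact fhbrDr f g h : fhbr f (g + h) = fhbr f g + fhbr f h.
Proof. by rewrite fhbrC fhbrDl opprD -!fhbrC. Qed.
Fact fhbrZr (k : K) f g : fhbr f (k *: g) = k *: fhbr f g.
Proof. by rewrite fhbrC fhbrZl -scalerN -fhbrC. Qed.
Fact fhbrxx f : fhbr f f = 0.
Proof.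
apply: fmhatP => d /=; rewrite (conv_pairs (fun i j => [lie fcomp f i, fcomp f j]) (ltnSn d)).
pose G i j := if (i + j == d)%N then [lie fcomp f i, fcomp f j] else 0.
suff h N : \sum_(i < N) \sum_(j < N) G i j = 0 by exact: h.
elim: N => [|N IH]; first by rewrite big_ord0.
rewrite big_ord_recr /= (eq_bigr (fun i : 'I_N => \sum_(j < N) G i j + G i N)); last first.
  by move=> i _; rewrite big_ord_recr.
rewrite big_split /= IH add0r big_ord_recr /= addrA -big_split /= /G liexx if_same addr0.
rewrite big1 // => i _; rewrite addnC; case: eqP => _; last by rewrite addr0.
by rewrite lieC addNr.
Qed.
Fact fhbr3E f g h d : fcomp (fhbr f (fhbr g h)) d =
  \sum_(i < d.+1) \sum_(j < d.+1) \sum_(k < d.+1)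
    if (i + j + k == d)%N then [lie fcomp f i, [lie fcomp g j, fcomp h k]] else 0.
Proof.
rewrite /=; apply: eq_bigr => i _.
rewrite (@conv_pairs _ (fun j k => [lie fcomp g j, fcomp h k]) d.+1); last first.
  by rewrite ltnS leq_subr.
rewrite lie_sumr; apply: eq_bigr => j _; rewrite lie_sumr; apply: eq_bigr => k _.
have -> : (i + j + k == d)%N = (j + k == d - i)%N.
  by rewrite -addnA -(eqn_add2l i (j + k)) subnKC ?leq_ord.
by case: ifP => // _; rewrite lie0r.
Qed.
Fact fhbr_jacobi f g h : fhbr f (fhbr g h) + fhbr g (fhbr h f) + fhbr h (fhbr f g) = 0.
Proof.
apply: fmhatP => d; transitivity (fcomp (fhbr f (fhbr g h)) d +
    fcomp (fhbr g (fhbr h f)) d + fcomp (fhbr h (fhbr f g)) d) => //.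
rewrite [RHS]/= !fhbr3E.
rewrite [X in _ + X + _](_ : _ = \sum_(i < d.+1) \sum_(j < d.+1) \sum_(k < d.+1)
    if (i + j + k == d)%N then [lie fcomp g j, [lie fcomp h k, fcomp f i]] else 0).
  rewrite [X in _ + X](_ : _ = \sum_(i < d.+1) \sum_(j < d.+1) \sum_(k < d.+1)
      if (i + j + k == d)%N then [lie fcomp h k, [lie fcomp f i, fcomp g j]] else 0).
    rewrite -!big_split big1 // => i _; rewrite -!big_split big1 // => j _.
    rewrite -!big_split big1 // => k _ /=.
    by case: eqP => _; rewrite ?addr0 // lie_jacobi.
  rewrite exchange_big; apply: eq_bigr => i _ /=; rewrite exchange_big; apply: eq_bigr => j _.
  by apply: eq_bigr => k _ /=; rewrite [(i + j + k)%N]addnC addnA.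
under eq_bigr do rewrite exchange_big /=.
rewrite exchange_big; apply: eq_bigr => i _ /=; apply: eq_bigr => j _.
by apply: eq_bigr => k _ /=; rewrite -[(i + j + k)%N]addnA [(i + (j + k))%N]addnC.
Qed.
HB.instance Definition _ := Lmodule_isLie.Build K fmhat
  fhbrDl fhbrDr fhbrZl fhbrZr fhbrxx fhbr_jacobi.
End Completion.

Section Calculus.
Variables (K : fieldType) (m : nat).
Local Notation Fhat := (fmhat K m).
Local Notation S := (powser K m).
Implicit Types u v f g : Fhat.

Fact yhat_subproof (i : 'I_m) d :
  homogeneous d (if d == 1%N then fmgen K i else 0).
Proof.
case: eqP => [->|_]; last exact: in_span0.
by apply: in_span1; exact: mono_gen.
Qed.
Definition yhat (i : 'I_m) : Fhat := FMHat (yhat_subproof i).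

Definition fhsum : (nat -> Fhat) -> Fhat := fsum (@fcomp K m).

Lemma fhsumE (v : nat -> Fhat) :
  (forall k d, (d < k)%N -> fcomp (v k) d = 0) ->
  forall d, fcomp (fhsum v) d = \sum_(k < d.+1) fcomp (v k) d.
Proof.
move=> v0.
have hs d : homogeneous d (\sum_(k < d.+1) fcomp (v k) d).
  by apply: in_span_sum => k _; exact: fcompP.
suff -> : fhsum v = FMHat hs by [].
apply: fsum_eq => [f g|d]; first exact: fmhatP.
exists d.+1 => M dM; rewrite fcomp_sum [RHS](big_ord_widen M (fun k => fcomp (v k) d)) //.
rewrite [RHS]big_mkcond; apply: eq_bigr => k _; case: ltnP => // dk.
exact: v0.
Qed.

Lemma psumE (v : nat -> S) :
  (forall k a, (mdeg a < k)%N -> pcoef (v k) a = 0) ->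
  forall a, pcoef (psum v) a = \sum_(k < (mdeg a).+1) pcoef (v k) a.
Proof.
move=> v0 a0.
suff -> : psum v = PowSer (fun a => \sum_(k < (mdeg a).+1) pcoef (v k) a) by [].
apply: fsum_eq => [f g|a]; first exact: powserP.
exists (mdeg a).+1 => M dM /=.
rewrite (big_morph (fun s : S => pcoef s a) (id1 := 0) (op1 := +%R)) //.
rewrite [RHS](big_ord_widen M (fun k => pcoef (v k) a)) //.
rewrite [RHS]big_mkcond; apply: eq_bigr => k _; case: ltnP => // dk.
exact: v0.
Qed.

(* [v exp(ad u)]; the series always converges since [fcomp u 0 = 0]. *)
Definition exp_ad u : Fhat -> Fhat :=
  fun v => fhsum (fun k => (k`!%:R : K)^-1 *: iter k (ad u) v).

(* [v (ad y_1)^(a_1) ... (ad y_m)^(a_m)]; the order of the factors is irrelevant *)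
(* for [v] in the commutator ideal. *)
Definition ad_monomial (a : 'X_{1..m}) v : Fhat :=
  foldl (fun w i => iter (a i) (ad (yhat i)) w) v (enum 'I_m).

(* [v h(ad y_1, ..., ad y_m)], meaningful for [v] in the commutator ideal. *)
Definition ad_series (h : S) v : Fhat :=
  fhsum (fun k => \sum_(a : 'X_{1..m < k.+1} | mdeg a == k)
                    pcoef h a *: ad_monomial a v).

Lemma fcomp0 f : fcomp f 0 = 0.
Proof. exact/homogeneous0/fcompP. Qed.

Lemma ad_low n f u : (forall d, (d < n)%N -> fcomp f d = 0) ->
  forall d, (d < n.+1)%N -> fcomp (ad u f) d = 0.
Proof.
move=> f0 d; rewrite ltnS => dn; apply: big1 => i _.
have [id|id] := ltnP i d; first by rewrite f0 ?lie0l // (leq_trans id).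
by move: id; rewrite -subn_eq0 => /eqP ->; rewrite fcomp0 lie0r.
Qed.

Lemma ad_iter_low n k f u : (forall d, (d < n)%N -> fcomp f d = 0) ->
  forall d, (d < n + k)%N -> fcomp (iter k (ad u) f) d = 0.
Proof.
by move=> f0; elim: k => [|k IH] d; [rewrite addn0; exact: f0|rewrite addnS; exact: ad_low].
Qed.

Lemma exp_adE u v d : fcomp (exp_ad u v) d =
  \sum_(k < d.+1) (k`!%:R : K)^-1 *: fcomp (iter k (ad u) v) d.
Proof.
rewrite fhsumE // => k e ek; rewrite /= (@ad_iter_low 0) ?scaler0 //.
Qed.

Lemma ad_monomial_low a v d : (d < mdeg a)%N -> fcomp (ad_monomial a v) d = 0.
Proof.
rewrite mdegE -big_enum /ad_monomial /=.
have : forall n w, (forall e, (e < n)%N -> fcomp w e = 0) ->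
   (d < n + \sum_(i <- enum 'I_m) a i)%N ->
   fcomp (foldl (fun w i => iter (a i) (ad (yhat i)) w) w (enum 'I_m)) d = 0.
  elim: (enum 'I_m) => [|i s IH] n w w0; first by rewrite big_nil addn0 => /w0.
  rewrite big_cons addnA /= => dn; apply: IH dn.
  exact: ad_iter_low.
by move=> h; exact: (h 0%N).
Qed.

Lemma ad_seriesE h v d : fcomp (ad_series h v) d =
  \sum_(k < d.+1) \sum_(a : 'X_{1..m < k.+1} | mdeg a == k)
     pcoef h a *: fcomp (ad_monomial a v) d.
Proof.
rewrite fhsumE => [|k e ek].
  by apply: eq_bigr => k _; rewrite fcomp_sum.
rewrite fcomp_sum big1 // => a /eqP ak.
by rewrite /= ad_monomial_low ?scaler0 // ak.
Qed.

(* The coordinates of an element of the completed wreath product: the coefficient *)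
(* of [a_i t^a] for [(i, Some a)] and that of [b_i] for [(i, None)]. *)
Definition wcoord (w : wreath (@psvar K m)) (k : 'I_m * option 'X_{1..m}) : K :=
  if k.2 is Some a then pcoef (w.1 k.1) a else w.2 k.1.

Definition wincl (w : wreath (@polyvar K m)) : wreath (@psvar K m) :=
  ([ffun i => ps_of_mpoly (w.1 i)], w.2).

(* The continuous extension of [eps] to the completions. *)
Definition epshat f : wreath (@psvar K m) :=
  fsum wcoord (fun d => wincl (eps (fcomp f d))).

Definition pderiv (i : 'I_m) f : S := (epshat f).1 i.

Lemma epshatE f : epshat f =
  ([ffun i => PowSer (fun a => ((eps (fcomp f (mdeg a).+1)).1 i)@_a)],
   (eps (fcomp f 1)).2).
Proof.
have wcD p q k : wcoord (p + q) k = wcoord p k + wcoord q k.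
  by case: k => i [a|]; rewrite /wcoord /= ffunE.
have wc0 k : wcoord 0 k = 0 by case: k => i [a|]; rewrite /wcoord /= ffunE.
apply: fsum_eq => [[p1 p2] [q1 q2] pq|[i [a|]]].
- congr pair; apply/ffunP => i; last exact: pq (i, None).
  by apply: powserP => a; exact: pq (i, Some a).
- exists (mdeg a).+2 => M aM.
  rewrite (big_morph (wcoord^~ (i, Some a)) (id1 := 0) (op1 := +%R)) //.
  rewrite (bigD1 (Ordinal aM)) //= /wcoord /= !ffunE /= big1 ?addr0 // => d dM.
  apply/eqP; apply: contraTT isT; rewrite ffunE /= => nz; case/eqP: dM; apply: val_inj => /=.
  by have [h _] := eps_homogeneous (fcompP f d); rewrite (h _ _ nz).
exists 2%N => M aM.
rewrite (big_morph (wcoord^~ (i, None)) (id1 := 0) (op1 := +%R)) //.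
rewrite (bigD1 (Ordinal aM)) //= /wcoord /= big1 ?addr0 // => d dM.
apply/eqP; apply: contraTT isT => nz; case/eqP: dM; apply: val_inj => /=.
by have [_ h] := eps_homogeneous (fcompP f d); rewrite (h _ nz).
Qed.

Lemma pderivE i f a :
  pcoef (pderiv i f) a = ((eps (fcomp f (mdeg a).+1)).1 i)@_a.
Proof. by rewrite /pderiv epshatE ffunE. Qed.

(* Row [i], column [j]: derivative with respect to [y_i] of the image of [y_j]. *)
Definition Jacobian (phi : Fhat -> Fhat) : 'M[S]_m :=
  \matrix_(i, j) pderiv i (phi (yhat j)).
End Calculus.

(* Main.v *)
(* The embedding [epshat] of the completion into the wreath product is a Lie
   homomorphism, and [ad u] acts on the image of the commutator ideal as
   multiplication by the element of [K[[t_1, ..., t_m]]] given by the linear part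
   of [u].  Hence the terms [y_j (ad u)^(k+1) / (k+1)!] of [exp (ad u)] have the
   derivatives of [[y_j, u]] times [t^k / (k+1)!], which sum up to the factor [T];
   the term [u0] contributes nothing to [t] and enters only through [[y_j, u]]. *)
Require Import Defs.
From mathcomp Require Import all_boot all_algebra.
From mathcomp Require Import mpoly zify.

Import GRing.Theory.
Local Open Scope ring_scope.

Set Implicit Arguments.
Unset Strict Implicit.
Unset Printing Implicit Defensive.

(** * Coefficients of products of power series *)

Section PowerSeriesCoef.
Variables (K : fieldType) (m : nat).
Local Notation S := (powser K m).
Implicit Types f g h : S.

Lemma pcoefD f g a : pcoef (f + g) a = pcoef f a + pcoef g a.
Proof. by []. Qed.

Lemma pcoefZ (k : K) f a : pcoef (k *: f) a = k * pcoef f a.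
Proof. by []. Qed.

Lemma pcoef_sum I (r : seq I) (P : pred I) (G : I -> S) a :
  pcoef (\sum_(i <- r | P i) G i) a = \sum_(i <- r | P i) pcoef (G i) a.
Proof. exact: (big_morph (fun f : S => pcoef f a)). Qed.

(** Continuity of multiplication: it lets an infinite series be replaced by a finite truncation
    inside a product. *)
Lemma pcoefM_congr f g g' a :
  (forall b, (mdeg b <= mdeg a)%N -> pcoef g b = pcoef g' b) ->
  pcoef (f * g) a = pcoef (f * g') a.
Proof. by move=> gg'; apply: eq_bigr => b _; rewrite gg' // -ltnS bmdeg. Qed.

Lemma ps_of_mpolyM (p q : {mpoly K[m]}) :
  ps_of_mpoly (p * q) = ps_of_mpoly p * ps_of_mpoly q.
Proof. by apply: powserP => a; rewrite /= mcoeffM. Qed.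

Lemma ps_of_mpoly1 : ps_of_mpoly 1 = 1 :> S.
Proof. by apply: powserP => a; rewrite /= mcoeff1. Qed.

Lemma ps_of_mpolyX (b : 'X_{1..m}) :
  ps_of_mpoly 'X_[b] = \prod_i psvar K i ^+ b i :> S.
Proof.
have X_ k p : ps_of_mpoly (p ^+ k) = ps_of_mpoly p ^+ k :> S.
  by elim: k => [|k IH]; rewrite ?expr0 ?ps_of_mpoly1 // !exprS ps_of_mpolyM IH.
rewrite mpolyXE_id (big_morph _ ps_of_mpolyM ps_of_mpoly1).
by apply: eq_bigr => i _; rewrite X_.
Qed.

(** Agreement is asked in a single degree only, because one homogeneous component of an element of
    the completion determines its derivatives in just one degree. *)
Lemma pcoef_mulX f (p : {mpoly K[m]}) (j : 'I_m) a :
  (forall b, (mdeg b).+1 = mdeg a -> pcoef f b = p@_b) ->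
  pcoef (f * psvar K j) a = (p * 'X_j)@_a.
Proof.
move=> fp; rewrite mcoeffM; apply: eq_bigr => -[[b1 _] [b2 _]] /= /eqP ab.
rewrite mcoeffX; case: eqP => [jb|_]; last by rewrite !mulr0.
by rewrite fp // ab mdegD -jb mdeg1 addn1.
Qed.

(** Each factor has order at least one; this makes the series [T] converge. *)
Lemma pcoef_expn_low (f : S) k a :
  pcoef f 0%MM = 0 -> (mdeg a < k)%N -> pcoef (f ^+ k) a = 0.
Proof.
move=> f0; elim: k a => // k IH a ak; rewrite exprS; apply: big1 => -[[b1 _] [b2 _]] /= /eqP ab.
have [->|b10] := eqVneq b1 0%MM; first by rewrite f0 mul0r.
rewrite IH ?mulr0 //; rewrite ltnS in ak; apply: leq_trans ak.
by rewrite ab mdegD -[X in (X < _)%N]add0n ltn_add2r lt0n mdeg_eq0.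
Qed.

Lemma pcoef_mul_psum f (v : nat -> S) a :
  (forall k b, (mdeg b < k)%N -> pcoef (v k) b = 0) ->
  pcoef (f * psum v) a = \sum_(k < (mdeg a).+1) pcoef (f * v k) a.
Proof.
move=> v0; rewrite -pcoef_sum -mulr_sumr; apply: pcoefM_congr => b ba.
rewrite psumE // pcoef_sum (big_ord_widen (mdeg a).+1 (fun k => pcoef (v k) b)) ?ltnS //.
rewrite big_mkcond; apply: eq_bigr => k _; case: ltnP => // bk.
by rewrite v0.
Qed.

(** The grouping by degree mirrors [ad_series]. The bound [N] is left free because the Lie side sums
    one degree further than [mdeg a]. *)
Lemma pcoef_mul_series f h a N : (mdeg a < N)%N ->
  pcoef (f * h) a = \sum_(k < N) \sum_(b : 'X_{1..m < k.+1} | mdeg b == k)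
     pcoef h b * pcoef (f * ps_of_mpoly 'X_[b]) a.
Proof.
(* [g] is the truncation of [h] to degrees below [N], so it agrees with [h] up to degree
   [mdeg a]. *)
move=> aN; pose g : S := \sum_(k < N) \sum_(b : 'X_{1..m < k.+1} | mdeg b == k)
   pcoef h b *: ps_of_mpoly 'X_[b].
transitivity (pcoef (f * g) a).
  apply: pcoefM_congr => e ea; rewrite pcoef_sum.
  have eN : (mdeg e < N)%N by exact: leq_ltn_trans aN.
  rewrite (bigD1 (Ordinal eN)) //= [X in _ + X]big1 ?addr0 ?pcoef_sum => [|k ke].
    rewrite (bigD1 (BMultinom (ltnSn (mdeg e)))) //= mcoeffX eqxx mulr1.
    rewrite big1 ?addr0 // => b /andP[_ be]; rewrite mcoeffX.
    by case: eqP => [eb|_]; rewrite ?mulr0 //; case/eqP: be; exact: val_inj.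
  rewrite pcoef_sum big1 // => b /eqP bk; rewrite /= mcoeffX.
  by case: eqP => [be|_]; rewrite ?mulr0 //; case/eqP: ke; apply: val_inj; rewrite /= -bk be.
rewrite mulr_sumr pcoef_sum; apply: eq_bigr => k _.
rewrite mulr_sumr pcoef_sum; apply: eq_bigr => b _.
by rewrite -scalerAr.
Qed.
End PowerSeriesCoef.

(** * Homomorphisms of Lie algebras *)

Section LieHom.
Variables (K : fieldType) (V W : lieType K) (phi : V -> W).
Hypothesis phi_hom : lie_hom phi.

Lemma lie_homD x y : phi (x + y) = phi x + phi y.
Proof. by have [lin _] := phi_hom; rewrite -[x]scale1r lin !scale1r. Qed.

Lemma lie_hom0 : phi 0 = 0.
Proof. by apply: (addrI (phi 0)); rewrite -lie_homD !addr0. Qed.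

Lemma lie_homZ k x : phi (k *: x) = k *: phi x.
Proof. by have [lin _] := phi_hom; rewrite -[k *: x]addr0 lin lie_hom0 addr0. Qed.

Lemma lie_hom_sum I (r : seq I) (P : pred I) (F : I -> V) :
  phi (\sum_(i <- r | P i) F i) = \sum_(i <- r | P i) phi (F i).
Proof. exact: (big_morph phi lie_homD lie_hom0). Qed.

Lemma lie_hom_br x y : phi [lie x, y] = [lie phi x, phi y].
Proof. by have [_ br] := phi_hom; exact: br. Qed.
End LieHom.

(** * Brackets in the abelian wreath product *)

Section WreathTheory.
Variables (K : fieldType) (m : nat) (R : comAlgType K) (t : 'I_m -> R).
Implicit Types u v : wreath t.

Lemma wreath_lie1 u v i :
  [lie u, v].1 i = u.1 i * wact t v.2 - v.1 i * wact t u.2.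
Proof. by rewrite ffunE. Qed.

Lemma wreath_sum1 I (r : seq I) (P : pred I) (G : I -> wreath t) i :
  (\sum_(k <- r | P k) G k).1 i = \sum_(k <- r | P k) (G k).1 i.
Proof. by elim/big_rec2: _ => [|k x y _ <-]; rewrite ffunE. Qed.

Lemma wact_gen i : wact t (wgen t i).2 = t i.
Proof.
rewrite /wact (bigD1 i) //= ffunE eqxx scale1r big1 ?addr0 // => j ji.
by rewrite ffunE (negPf ji) scale0r.
Qed.
End WreathTheory.

(** * Partial derivatives on the completion *)

Section EmbeddingOfCompletion.
Variables (K : fieldType) (m : nat).
Local Notation Fhat := (fmhat K m).
Local Notation S := (powser K m).
(** The linear form in the [t_j] by which [ad u] acts on the image of the commutator ideal. *)
Local Notation wlin u := (wact (@psvar K m) (epshat u).2).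
Implicit Types u v f g : Fhat.

Lemma epshat2 f : (epshat f).2 = (eps (fcomp f 1)).2.
Proof. by rewrite epshatE. Qed.

(* The [B]-part of a homogeneous element vanishes unless its degree is [1]. *)
Lemma eps_lie1 (x y : freeMetab K m) i a d e :
  homogeneous d x -> homogeneous e y ->
  ((eps [lie x, y]).1 i)@_a =
    (if e == 1%N then (eps x).1 i * wact (@polyvar K m) (eps y).2 else 0)@_a
    - (if d == 1%N then (eps y).1 i * wact (@polyvar K m) (eps x).2 else 0)@_a.
Proof.
have act0 k z : homogeneous k z -> k != 1%N -> wact (@polyvar K m) (eps z).2 = 0.
  move=> /eps_homogeneous[_ z2] k1; apply: big1 => j _; apply/eqP.
  by rewrite scaler_eq0; apply/orP; left; apply: contraNT k1 => /z2 ->.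
move=> hx hy; rewrite (lie_hom_br (@eps_hom K m)) wreath_lie1 mcoeffB.
by congr (_ - _); case: eqP => // /eqP n1; rewrite (act0 _ _ _ n1) // mulr0.
Qed.

(** Derivation lowers the degree by one and the linear form raises it again, so only the component
    of [f] of degree [mdeg a] is seen. *)
Lemma pcoef_mul_wact f g i a :
  pcoef (pderiv i f * wlin g) a =
  ((eps (fcomp f (mdeg a))).1 i * wact (@polyvar K m) (eps (fcomp g 1)).2)@_a.
Proof.
rewrite epshat2 /wact !mulr_sumr pcoef_sum raddf_sum; apply: eq_bigr => j _.
rewrite -scalerAr pcoefZ -scalerAr [RHS]/= mcoeffZ; congr (_ * _).
by apply: pcoef_mulX => b ba; rewrite pderivE ba.
Qed.

Lemma epshat_hom : lie_hom (@epshat K m).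
Proof.
have eH := @eps_hom K m; split=> [k f g|f g].
  rewrite !epshatE; congr pair; apply/ffunP => i; last first.
    by rewrite /= (lie_homD eH) (lie_homZ eH).
  rewrite !ffunE; apply: powserP => a.
  by rewrite /= (lie_homD eH) (lie_homZ eH) !ffunE mcoeffD mcoeffZ.
have fg2 : (epshat [lie f, g]).2 = 0.
  by rewrite epshat2 /= (lie_hom_sum eH) big_ord_recl big_ord1 /= !(lie_hom_br eH) /= addr0.
suff fg1 : (epshat [lie f, g]).1 = [lie epshat f, epshat g].1.
  by case: (epshat _) fg1 fg2 => [p q] /= -> ->.
apply/ffunP => i; rewrite wreath_lie1 -[(epshat [lie f, g]).1 i]/(pderiv i [lie f, g]).
rewrite -!/(pderiv _ _); apply: powserP => a.
rewrite pcoefD -[pcoef (- _) a]/(- _) !pcoef_mul_wact pderivE /=.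
rewrite (lie_hom_sum eH) wreath_sum1 raddf_sum /=; set d := mdeg a.
under eq_bigr => k _ do rewrite (eps_lie1 _ _ (fcompP _ _) (fcompP _ _)).
(* Among the brackets of total degree [d + 1], the first sum keeps only [k = d], where the right
   argument has degree 1, and the second only [k = 1]. *)
rewrite sumrB; congr (_ - _).
  rewrite big_ord_recr /= big_ord_recr /= subSS subnn subSnn eqxx.
  rewrite mcoeff0 addr0 big1 ?add0r // => k _; case: eqP => [kd|_]; rewrite ?mcoeff0 //.
  by have := ltn_ord k; rewrite -subn_gt0; lia.
rewrite big_ord_recl big_ord_recl /= subSS subn0 mcoeff0 add0r.
by rewrite big1 ?addr0 // => k _; rewrite mcoeff0.
Qed.

Lemma pderivD i f g : pderiv i (f + g) = pderiv i f + pderiv i g.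
Proof. by rewrite /pderiv (lie_homD epshat_hom) ffunE. Qed.

Lemma pderiv_sum i I (r : seq I) (P : pred I) (G : I -> Fhat) :
  pderiv i (\sum_(k <- r | P k) G k) = \sum_(k <- r | P k) pderiv i (G k).
Proof. by rewrite /pderiv (lie_hom_sum epshat_hom) wreath_sum1. Qed.

Lemma pderiv_lie i f g :
  pderiv i [lie f, g] = pderiv i f * wlin g - pderiv i g * wlin f.
Proof. by rewrite /pderiv (lie_hom_br epshat_hom) wreath_lie1. Qed.

Lemma epshat_lie2 f g : (epshat [lie f, g]).2 = 0.
Proof. by rewrite (lie_hom_br epshat_hom). Qed.

Lemma epshat_yhat j : epshat (yhat K j) = wgen (@psvar K m) j.
Proof.
rewrite epshatE /= eps_gen; congr pair; apply/ffunP => i; rewrite !ffunE.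
apply: powserP => a /=; rewrite eqSS mdeg_eq0.
have [a0|a0] := eqVneq a 0%MM.
  by rewrite eps_gen ffunE; case: (i == j); rewrite ?mcoeff1 ?mcoeff0 //= a0 eqxx.
rewrite (lie_hom0 (@eps_hom K m)) ffunE mcoeff0.
by case: (i == j) => //=; rewrite (negPf a0).
Qed.

Lemma pderiv_yhat (i j : 'I_m) : pderiv i (yhat K j) = (i == j)%:R.
Proof. by rewrite /pderiv epshat_yhat ffunE. Qed.

Lemma wlin_yhat j : wlin (yhat K j) = psvar K j.
Proof. by rewrite epshat_yhat wact_gen. Qed.

Lemma pcoef_wlin0 u : pcoef (wlin u) 0%MM = 0.
Proof.
rewrite /wact pcoef_sum big1 // => j _; rewrite pcoefZ /= mcoeffX.
by rewrite -mdeg_eq0 mdeg1 mulr0.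
Qed.

(** The bound is [(mdeg a).+2] because coefficient [a] of a derivative comes from the component of
    degree [mdeg a + 1], which the terms up to that index can reach. *)
Lemma pcoef_pderiv_fhsum (v : nat -> Fhat) i a :
  (forall k d, (d < k)%N -> fcomp (v k) d = 0) ->
  pcoef (pderiv i (fhsum v)) a = \sum_(k < (mdeg a).+2) pcoef (pderiv i (v k)) a.
Proof.
move=> v0; rewrite pderivE fhsumE // (lie_hom_sum (@eps_hom K m)) wreath_sum1.
by rewrite raddf_sum; apply: eq_bigr => k _; rewrite pderivE.
Qed.

Lemma pderivZ i (k : K) f : pderiv i (k *: f) = k *: pderiv i f.
Proof. by rewrite /pderiv (lie_homZ epshat_hom) ffunE. Qed.

Lemma epshat_iter_ad2 u v k :
  (epshat v).2 = 0 -> (epshat (iter k (ad u) v)).2 = 0.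
Proof. by case: k => // k _; exact: epshat_lie2. Qed.

(** Without a linear part in [v], the second term of [pderiv_lie] vanishes at every step. *)
Lemma pderiv_iter_ad i u v k : (epshat v).2 = 0 ->
  pderiv i (iter k (ad u) v) = pderiv i v * wlin u ^+ k.
Proof.
move=> v2; elim: k => [|k IH]; first by rewrite mulr1.
by rewrite /= pderiv_lie epshat_iter_ad2 // wact0 mulr0 subr0 IH -mulrA -exprSr.
Qed.

(** Since [v] may have a linear part, the term [k = 0] is split off and [(ad u)^(k+1)] is read as
    [(ad u)^k] applied to [[v, u]], which lies in the commutator ideal. This shift produces the
    factorials [(k+1)!]. *)
Lemma pderiv_exp_ad i u v :
  pderiv i (exp_ad u v) = pderiv i v +
    pderiv i [lie v, u] * psum (fun k => ((k.+1)`!%:R : K)^-1 *: wlin u ^+ k).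
Proof.
apply: powserP => a.
rewrite pcoef_pderiv_fhsum => [|k d dk]; last first.
  by rewrite /= (@ad_iter_low _ _ 0) ?scaler0.
rewrite big_ord_recl pcoefD pcoef_mul_psum => [|k b bk]; last first.
  by rewrite pcoefZ pcoef_expn_low ?mulr0 // pcoef_wlin0.
congr (_ + _); first by rewrite fact0 invr1 scale1r.
apply: eq_bigr => k _; rewrite lift0 pderivZ iterSr pderiv_iter_ad; last exact: epshat_lie2.
by rewrite -scalerAr.
Qed.

Lemma pderiv_ad_monomial i b v : (epshat v).2 = 0 ->
  (epshat (ad_monomial b v)).2 = 0 /\
  pderiv i (ad_monomial b v) = pderiv i v * ps_of_mpoly 'X_[b].
Proof.
rewrite ps_of_mpolyX -big_enum /ad_monomial /=.
elim: (enum 'I_m) v => [|j s IH] v v2 /=; first by rewrite big_nil mulr1.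
have [w2 ->] := IH _ (epshat_iter_ad2 (yhat K j) (b j) v2); split=> //.
by rewrite pderiv_iter_ad // wlin_yhat big_cons mulrA.
Qed.

Lemma pderiv_ad_series i (h : S) v : (epshat v).2 = 0 ->
  pderiv i (ad_series h v) = pderiv i v * h.
Proof.
move=> v2; apply: powserP => a.
rewrite pcoef_pderiv_fhsum => [|k d dk]; last first.
  rewrite fcomp_sum big1 // => b /eqP bk.
  by rewrite /= ad_monomial_low ?scaler0 ?bk.
(* This [N] matches the range given by [pcoef_pderiv_fhsum], so the two sums compare term by
   term. *)
rewrite (@pcoef_mul_series _ _ _ _ _ (mdeg a).+2) //.
apply: eq_bigr => k _; rewrite pderiv_sum pcoef_sum; apply: eq_bigr => b _.
by rewrite pderivZ; have [_ ->] := pderiv_ad_monomial i b v2.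
Qed.

Lemma epshat_ad_series2 (h : S) v : (epshat v).2 = 0 -> (epshat (ad_series h v)).2 = 0.
Proof.
move=> v2; rewrite epshat2 ad_seriesE.
elim/big_ind: _ => [|x y x0 y0|k _]; rewrite ?(lie_hom0 (@eps_hom K m)) //.
  by rewrite (lie_homD (@eps_hom K m)) /= x0 y0 addr0.
elim/big_ind: _ => [|x y x0 y0|b _]; rewrite ?(lie_hom0 (@eps_hom K m)) //.
  by rewrite (lie_homD (@eps_hom K m)) /= x0 y0 addr0.
(* Passing to coordinates supplies the index [i] at which [pderiv_ad_monomial] is applied. *)
apply/ffunP => i; have [b2 _] := pderiv_ad_monomial i b v2.
by rewrite (lie_homZ (@eps_hom K m)) /= -epshat2 b2 scaler0.
Qed.
End EmbeddingOfCompletion.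

(** * The Jacobian matrix of an inner automorphism *)

Unset Implicit Arguments.

Theorem theorem5 (K : fieldType) (charK : [pchar K] =i pred0)
  (m : nat) (m_ge2 : (2 <= m)%N)
  (c : 'I_m -> K) (h : 'I_m -> 'I_m -> powser K m)
  (h_vars : forall p q : 'I_m, (q < p)%N -> vars_from q (h p q))
  (u ubar u0 : fmhat K m)
  (def_ubar : ubar = \sum_(r < m) c r *: yhat K r)
  (def_u0 : u0 = \sum_(p < m) \sum_(q < m | (q < p)%N)
                   ad_series (h p q) [lie yhat K p, yhat K q])
  (def_u : u = ubar + u0) :
  let t : powser K m := \sum_(r < m) c r *: psvar K r in
  let T : powser K m := psum (fun k => ((k.+1)`!%:R : K)^-1 *: t ^+ k) in
  let Dbar : 'M[powser K m]_m :=
    \matrix_(i, j) pderiv i [lie yhat K j, ubar] in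
  let D0 : 'M[powser K m]_m :=
    \matrix_(i, j) pderiv i [lie yhat K j, u0] in
  let f (i : 'I_m) : powser K m :=
    \sum_(p < m) \sum_(q < m | (q < p)%N)
      pderiv i (ad_series (h p q) [lie yhat K p, yhat K q]) in
  [/\ Jacobian (exp_ad u) = Jacobian (exp_ad ubar) + T *: D0,
      Jacobian (exp_ad u) = 1%:M + T *: (Dbar + D0),
      forall i j : 'I_m, Dbar i j =
        if i == j then \sum_(r < m | r != j) c r *: psvar K r
        else - (c i *: psvar K j),
      forall i j : 'I_m, D0 i j = - (psvar K j * f i)
    & forall i : 'I_m, f i =
        \sum_(q < m | (q < i)%N) psvar K q * h i q
        - \sum_(p < m | (i < p)%N) psvar K p * h p i].
Proof.
move=> t T Dbar D0 f.
(* Each summand of [u0] is a series of operators applied to a commutator. *)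
have u02 : (epshat u0).2 = 0.
  rewrite def_u0 (lie_hom_sum (@epshat_hom K m)).
  elim/big_ind: _ => //= [x y|p _]; first by move=> -> ->; rewrite addr0.
  rewrite (lie_hom_sum (@epshat_hom K m)).
  elim/big_ind: _ => //= [x y|q _]; first by move=> -> ->; rewrite addr0.
  exact/epshat_ad_series2/epshat_lie2.
have ubar_t : wact (@psvar K m) (epshat ubar).2 = t.
  rewrite def_ubar (lie_hom_sum (@epshat_hom K m)).
  rewrite (big_morph (fun w : wreath (@psvar K m) => wact (@psvar K m) w.2)
    (id1 := 0) (op1 := +%R)) => [|x y|]; [|exact: wactD|exact: wact0].
  by apply: eq_bigr => r _; rewrite (lie_homZ (@epshat_hom K m)) wactZ wlin_yhat.
have u_t : wact (@psvar K m) (epshat u).2 = t.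
  by rewrite def_u (lie_homD (@epshat_hom K m)) wactD u02 wact0 addr0.
have pderiv_ubar i : pderiv i ubar = c i *: 1.
  rewrite def_ubar pderiv_sum (bigD1 i) //= big1 => [|r ri].
    by rewrite addr0 pderivZ pderiv_yhat eqxx.
  by rewrite pderivZ pderiv_yhat eq_sym (negPf ri) scaler0.
have Jubar : Jacobian (exp_ad ubar) = 1%:M + T *: Dbar.
  by apply/matrixP => i j; rewrite !mxE pderiv_exp_ad pderiv_yhat ubar_t mulrC.
have Ju : Jacobian (exp_ad u) = 1%:M + T *: (Dbar + D0).
  apply/matrixP => i j; rewrite !mxE pderiv_exp_ad pderiv_yhat u_t mulrC.
  by rewrite -pderivD -lieDr -def_u.
split=> // [|i j|i j|i].
- by rewrite Ju Jubar scalerDr addrA.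
- rewrite mxE pderiv_lie wlin_yhat ubar_t pderiv_ubar pderiv_yhat -scalerAl mul1r.
  case: eqP => [->|_]; last by rewrite mul0r add0r.
  (* On the diagonal the entry is [t - c_j t_j], which removes the term [r = j] from [t]. *)
  by rewrite mul1r /t (bigD1 j) //= addrC addrK.
(* As [u0] acts by zero, only the term with the derivative of [u0] survives, and that derivative is
   [f i] by linearity. *)
- rewrite mxE pderiv_lie wlin_yhat u02 wact0 mulr0 sub0r mulrC def_u0 pderiv_sum.
  by congr (- (_ * _)); apply: eq_bigr => p _; rewrite pderiv_sum.
(* The derivative of [[y_p, y_q]] is [t_q] if [i = p], [- t_p] if [i = q], and zero otherwise; the
   Kronecker deltas then collapse the double sum. *)
pose F (p q : 'I_m) := (i == p)%:R * (psvar K q * h p q) - (i == q)%:R * (psvar K p * h p q).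
have -> : f i = \sum_(p < m) \sum_(q < m | (q < p)%N) F p q.
  apply: eq_bigr => p _; apply: eq_bigr => q _.
  rewrite pderiv_ad_series ?epshat_lie2 // pderiv_lie !wlin_yhat !pderiv_yhat.
  by rewrite mulrBl -!mulrA.
under eq_bigr => p _ do rewrite sumrB.
rewrite sumrB; congr (_ - _).
  rewrite (bigD1 i) //= eqxx [X in _ + X]big1 ?addr0 => [|p pi].
    by apply: eq_bigr => q _; rewrite mul1r.
  by apply: big1 => q _; rewrite eq_sym (negPf pi) mul0r.
(* Here the delta fixes the inner index, [q = i], so the condition [q < p] becomes the condition
   [i < p] on the outer sum. *)
rewrite [RHS]big_mkcond; apply: eq_bigr => p _.
rewrite big_mkcond (bigD1 i) //= eqxx mul1r big1 ?addr0 // => q qi.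
by rewrite eq_sym (negPf qi) mul0r if_same.
Qed.
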